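(* Let $\alpha,\beta\in[0,\pi/2]$ with $\alpha\neq\beta$ and $\alpha\neq\pi/2-\beta$, and consider the orthonormal basis of $\mathbb{C}^2\otimes\mathbb{C}^2$ given by $\ket{a_1}=\ket{\phi^-_\alpha}$, $\ket{a_2}=\ket{\psi^-_\beta}$, $\ket{a_3}=\tfrac{1}{\sqrt2}(\ket{\phi^+_\alpha}+\ket{\psi^+_\beta})$, $\ket{a_4}=\tfrac{1}{\sqrt2}(\ket{\phi^+_\alpha}-\ket{\psi^+_\beta})$, where $\ket{\phi^+_\theta}=\sin\theta\ket{00}+\cos\theta\ket{11}$, $\ket{\phi^-_\theta}=\cos\theta\ket{00}-\sin\theta\ket{11}$, $\ket{\psi^+_\theta}=\sin\theta\ket{01}+\cos\theta\ket{10}$, $\ket{\psi^-_\theta}=\cos\theta\ket{01}-\sin\theta\ket{10}$, with the states sampled uniformly. Then this set is perfectly distinguishable under adaptive LOCC if and only if three copies of the state are available; i.e., it is perfectly distinguishable by an adaptive LOCC strategy with three copies but not with two (or one).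
   Context: Two spatially separated parties (Alice holding the first qubit, Bob the second) are given $k$ copies $\ket{a_i}^{\otimes k}$ of an unknown state from the known set and must identify $i$ with certainty. In an adaptive LOCC strategy each copy is addressed individually by local quantum operations and classical communication (LOCC) acting on that copy only, and the strategy on later copies may depend on outcomes obtained from earlier copies. $\{\ket{0},\ket{1}\}$ is the computational basis, $\ket{ab}=\ket{a}\otimes\ket{b}$. *)

(* Defs.v *)
From HB Require Import structures.
From mathcomp Require Import all_boot all_order all_algebra.
From mathcomp Require Import all_classical all_reals.
From mathcomp Require Import trigo.
From mathcomp Require Import complex mxtens.
Set Implicit Arguments. Unset Strict Implicit. Unset Printing Implicit Defensive.
Import Order.TTheory GRing.Theory Num.Theory.
Local Open Scope ring_scope.

Section QDefs.
Variable R : realType.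
Local Notation C := R[i].

Definition M2 := 'M[C]_2.
Definition ket2 := 'cV[C]_(2 * 2).

Definition adj {m n} (A : 'M[C]_(m, n)) : 'M[C]_(n, m) := (map_mx Num.conj A)^T.

Definition ket1 (a : 'I_2) : 'cV[C]_2 := delta_mx a 0.
Definition ket (a b : 'I_2) : ket2 := ket1 a *t ket1 b.

Definition r2c (x : R) : C := (x%:C)%C.

Definition phi_p (t : R) : ket2 := r2c (sin t) *: ket 0 0 + r2c (cos t) *: ket 1 1.
Definition phi_m (t : R) : ket2 := r2c (cos t) *: ket 0 0 - r2c (sin t) *: ket 1 1.
Definition psi_p (t : R) : ket2 := r2c (sin t) *: ket 0 1 + r2c (cos t) *: ket 1 0.
Definition psi_m (t : R) : ket2 := r2c (cos t) *: ket 0 1 - r2c (sin t) *: ket 1 0.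

Definition basis_state (al be : R) (i : 'I_4) : ket2 :=
  match val i with
  | 0 => phi_m al
  | 1 => psi_m be
  | 2 => r2c (Num.sqrt 2)^-1 *: (phi_p al + psi_p be)
  | _ => r2c (Num.sqrt 2)^-1 *: (phi_p al - psi_p be)
  end.

Definition instrument (Ks : seq M2) : Prop :=
  \sum_(K <- Ks) (adj K *m K) = 1%:M.

(** Finite-round LOCC protocols acting on ONE copy, described by their list of
    leaves.  Each leaf is a pair (A, B) where A (resp. B) is the product of
    Alice's (resp. Bob's) Kraus operators along the branch; the unnormalized
    post-measurement state at the leaf is (A (x) B)|psi>.  A protocol starts
    from the trivial one and repeatedly lets Alice or Bob apply a local
    instrument at some leaf (all earlier outcomes being broadcast). *)
Inductive LOCC : seq (M2 * M2) -> Prop :=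
| LOCC_triv : LOCC [:: (1%:M, 1%:M)]
| LOCC_Alice s1 A B s2 (Ks : seq M2) :
    LOCC (s1 ++ (A, B) :: s2) -> instrument Ks ->
    LOCC (s1 ++ [seq (K *m A, B) | K <- Ks] ++ s2)
| LOCC_Bob s1 A B s2 (Ks : seq M2) :
    LOCC (s1 ++ (A, B) :: s2) -> instrument Ks ->
    LOCC (s1 ++ [seq (A, K *m B) | K <- Ks] ++ s2).

(** Leaf l of a protocol occurs with nonzero probability on |psi>. *)
Definition reaches (l : M2 * M2) (psi : ket2) : bool :=
  (l.1 *t l.2) *m psi != 0.

(** [adaptive_ok st k S]: starting from the candidate set S of indices still
    consistent with the outcomes obtained so far, k further copies allow one to
    identify the index with certainty, by an adaptive strategy in which each
    copy is measured by a one-copy LOCC protocol chosen depending on the earlier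
    outcomes. *)
Fixpoint adaptive_ok (n : nat) (st : 'I_n -> ket2) (k : nat) (S : {set 'I_n}) : Prop :=
  match k with
  | 0 => forall i j, i \in S -> j \in S -> i = j
  | k'.+1 => exists s, LOCC s /\
       forall l, l \in s -> adaptive_ok st k' [set i in S | reaches l (st i)]
  end.

Definition adaptive_LOCC_distinguishable (n : nat) (st : 'I_n -> ket2) (k : nat) : Prop :=
  adaptive_ok st k [set: 'I_n].

End QDefs.

(* Main.v *)
Require Import Defs.
From HB Require Import structures.
From mathcomp Require Import all_boot all_order all_algebra.
From mathcomp Require Import all_classical all_reals.
From mathcomp Require Import trigo.
From mathcomp Require Import complex mxtens.
From mathcomp Require Import ring lra.
Set Implicit Arguments. Unset Strict Implicit. Unset Printing Implicit Defensive.
Import Order.TTheory GRing.Theory Num.Theory.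
Local Open Scope ring_scope.

(* Write the four states as 2 x 2 amplitude matrices M i; a leaf (A, B) of a
   protocol excludes state i iff A (M i) B^T = 0.

   With n.-1 copies any n orthogonal real states are distinguishable: by
   Walgate's argument each copy separates a chosen pair, hence removes a
   candidate.

   Conversely, no protocol on one copy excludes two of the four states at every
   leaf. At most one M i is singular, i.e. at most one state is a product state.
   Consider a node where B has just become singular, of row space b, while A is
   still invertible. If no (M i) b vanishes, then the ways in which A's holder can
   finish force the four vectors (M i) b into two parallel pairs, which the
   conditions on the angles forbid. So b annihilates the product state, and
   likewise when A becomes singular first; but a party cannot have all its
   outcomes annihilate the same state. Hence some leaf of the first copy keeps
   three candidates, and some leaf of the second keeps two of them. *)

(** * Linear algebra over a field: exclusion passes from the outcomes of an instrument back to their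
    node *)

Section Exclusion.
Variable F : fieldType.

Definition par (u v : 'cV[F]_2) : Prop := u 0 0 * v 1 0 = u 1 0 * v 0 0.

Lemma par_sym u v : par u v -> par v u.
Proof. by rewrite /par => h; rewrite mulrC -h mulrC. Qed.

Lemma cV2P (u v : 'cV[F]_2) : u 0 0 = v 0 0 -> u 1 0 = v 1 0 -> u = v.
Proof.
move=> h0 h1; apply/colP=> i; case: (unliftP 0 i) => [j ->|->] //.
by rewrite ord1; have -> : lift 0 0 = 1 :> 'I_2 by apply/val_inj.
Qed.

Lemma par_scale u v : v != 0 -> par u v -> exists c, u = c *: v.
Proof.
rewrite /par => v0 uv; case: (eqVneq (v 0 0) 0) => [z|nz]; last first.
  exists (u 0 0 / v 0 0); apply: cV2P; rewrite !mxE; first by field.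
  by apply: (mulIf nz); rewrite -uv; field.
have nz1 : v 1 0 != 0.
  by apply: contra_neq v0 => z1; apply: cV2P; rewrite !mxE.
exists (u 1 0 / v 1 0); apply: cV2P; rewrite !mxE; last by field.
by apply: (mulIf nz1); rewrite uv; field.
Qed.

(** A singular [A] has rank at most one, so a nonzero [K *m A] has the same row space and [A] is a
    left multiple of it. *)
Lemma singular_factor n (A K : 'M[F]_2) (X : 'M[F]_(2, n)) :
  A \notin unitmx -> K *m A != 0 -> K *m A *m X = 0 -> A *m X = 0.
Proof.
move=> Au KA0 KAX.
have /submxP[D ->] : (A <= K *m A)%MS.
  rewrite -(mxrank_leqif_sup (submxMl K A)) eqn_leq mxrankM_maxr /=.
  move: Au; rewrite -row_free_unit /row_free => Au.
  have := rank_leq_row A; rewrite leq_eqVlt (negbTE Au) /= => h.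
  by apply: leq_trans (h : \rank A <= 1)%N _; rewrite lt0n mxrank_eq0.
by rewrite -mulmxA KAX mulmx0.
Qed.

(** Dually, a nonzero [A *m D] has the same column space as [A], so [A] is a right multiple of
    it. *)
Lemma singular_factor_r n (A K : 'M[F]_2) (D : 'M[F]_(2, n)) :
  A \notin unitmx -> A *m D != 0 -> K *m (A *m D) = 0 -> K *m A = 0.
Proof.
move=> Au AD0 KAD.
have /submxP[E] : (A^T <= (A *m D)^T)%MS.
  rewrite -(mxrank_leqif_sup (_ : ((A *m D)^T <= A^T)%MS)); last first.
    by rewrite trmx_mul submxMl.
  rewrite !mxrank_tr eqn_leq mxrankM_maxl /=.
  move: Au; rewrite -row_free_unit /row_free => Au.
  have := rank_leq_row A; rewrite leq_eqVlt (negbTE Au) /= => h.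
  by apply: leq_trans (h : \rank A <= 1)%N _; rewrite lt0n mxrank_eq0.
move=> /(congr1 trmx); rewrite trmx_mul !trmxK => ->.
by rewrite mulmxA KAD mul0mx.
Qed.

(** The kernel of a nonzero 2 x 2 matrix is at most a line; the proof is Cramer's rule on each row
    of [W]. *)
Lemma singular_par (W : 'M[F]_2) (u v : 'cV[F]_2) :
  W != 0 -> W *m u = 0 -> W *m v = 0 -> par u v.
Proof.
move=> W0 Wu Wv; apply/eqP; apply: contraNT W0 => uv.
apply/eqP/matrixP => a b; rewrite [RHS]mxE.
have := congr1 (fun M : 'cV_2 => M a 0) Wu.
have := congr1 (fun M : 'cV_2 => M a 0) Wv.
rewrite !mxE !big_ord_recl !big_ord0 !addr0.
have -> : lift 0 0 = 1 :> 'I_2 by apply/val_inj.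
set p := W a 0; set q := W a 1 => hv hu.
have d0 : u 0 0 * v 1 0 - u 1 0 * v 0 0 != 0 by rewrite subr_eq0.
have p0 : p = 0.
  apply: (mulIf d0); rewrite mul0r.
  transitivity ((p * u 0 0 + q * u 1 0) * v 1 0 - (p * v 0 0 + q * v 1 0) * u 1 0); first by ring.
  by rewrite hu hv; ring.
have q0 : q = 0.
  apply: (mulIf d0); rewrite mul0r.
  transitivity ((p * v 0 0 + q * v 1 0) * u 0 0 - (p * u 0 0 + q * u 1 0) * v 0 0); first by ring.
  by rewrite hu hv; ring.
case: (unliftP 0 b) => [j ->|->] //.
by rewrite ord1; have -> : lift 0 0 = 1 :> 'I_2 by apply/val_inj.
Qed.

Variable M : 'I_4 -> 'M[F]_2.

Definition excluded (A B : 'M[F]_2) (i : 'I_4) : Prop := A *m M i *m B^T = 0.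

(* The condition that propagates from the leaves of a protocol back to its root:
   a node excludes two states, or it excludes one state while one of the parties
   has not lost any information yet. It fails at the root. *)
Definition excluding (A B : 'M[F]_2) : Prop :=
  (exists i j, [/\ i != j, excluded A B i & excluded A B j])
  \/ (exists2 i, excluded A B i & (A \in unitmx) || (B \in unitmx)).

(** Stands in for the completeness of an instrument over an arbitrary field, where there is no
    adjoint. *)
Definition jointly_injective (Ks : seq 'M[F]_2) : Prop :=
  forall X : 'M[F]_2, (forall K, K \in Ks -> K *m X = 0) -> X = 0.

Hypothesis M_neq0 : forall i, M i != 0.
Hypothesis M_unit : forall i j, i != j -> (M i \in unitmx) || (M j \in unitmx).
Hypothesis M_par : forall (i j k l : 'I_4) (b : 'cV[F]_2), uniq [:: i; j; k; l] ->
  par (M i *m b) (M j *m b) -> par (M k *m b) (M l *m b) -> b = 0.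

Lemma excluding_Alice (Ks : seq 'M[F]_2) A B : jointly_injective Ks ->
  (forall K, K \in Ks -> excluding (K *m A) B) -> excluding A B.
Proof.
move=> KsI KsP.
have inj (X : 'M[F]_2) : X != 0 -> exists2 K, K \in Ks & K *m X != 0.
  move=> X0; apply: contrapT => h; move/eqP: X0; apply; apply: KsI => K KK.
  by apply/eqP; apply: contrapT => KX; apply: h; exists K => //; apply/negP.
case: (eqVneq A 0) => [->|A0].
  by left; exists 0, 1; split=> //; rewrite /excluded !mul0mx.
case: (eqVneq B 0) => [->|B0].
  by left; exists 0, 1; split=> //; rewrite /excluded trmx0 mulmx0.
(* If [A] is singular, [singular_factor] pulls back the exclusions of any [K] with [K *m A] nonzero.
   As [K *m A] is singular too, a single exclusion can only come with [B] invertible. *)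
case: (boolP (A \in unitmx)) => Au; last first.
  have [K KK KA0] := inj A A0.
  have ex i : excluded (K *m A) B i -> excluded A B i.
    by rewrite /excluded -!mulmxA mulmxA; apply: singular_factor.
  case: (KsP K KK) => [[i [j [ij /ex ei /ex ej]]]|[i /ex ei h]].
    by left; exists i, j.
  right; exists i => //; rewrite (negbTE Au) /=.
  by move: h; rewrite unitmx_mul (negbTE Au) andbF.
(* An invertible [K] can be cancelled; since [A] is invertible, one exclusion is then enough. *)
have [[K KK Ku]|noK] := pselect (exists2 K, K \in Ks & K \in unitmx).
  have ex i : excluded (K *m A) B i -> excluded A B i.
    rewrite /excluded => h; rewrite -[LHS](mulKmx Ku).
    by rewrite [K *m _]mulmxA [K *m _]mulmxA h mulmx0.
  right; rewrite Au /=.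
  by case: (KsP K KK) => [[i [j [ij /ex ei /ex ej]]]|[i /ex ei h]]; exists i.
have Ksing K : K \in Ks -> K \notin unitmx.
  by move=> KK; apply/negP => Ku; apply: noK; exists K.
(* From here on every [K] is singular. If [B] is invertible, a nonzero [K] can only exclude an [i]
   with [M i] singular, and there is just one such [i]. All the [K] then kill the same [A *m M i],
   which is nonzero: a contradiction. *)
case: (boolP (B \in unitmx)) => Bu.
  have sing K : K \in Ks -> exists2 i, M i \notin unitmx \/ K = 0 & K *m A *m M i = 0.
    move=> KK; have [i ei] : exists i, excluded (K *m A) B i.
      by case: (KsP K KK) => [[i [j [ij ei ej]]]|[i ei h]]; exists i.
    have {}ei : K *m A *m M i = 0.
      by rewrite -[LHS](mulmxK (_ : B^T \in unitmx)) ?unitmx_tr // ei mul0mx.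
    exists i => //; case: (boolP (M i \in unitmx)) => Mu; [right|by left].
    by rewrite -[K](mulmxK Au) -[K *m A](mulmxK Mu) ei !mul0mx.
  have [K0 K0K K0A] := inj A A0.
  have [i0 [Mi0|z] ei0] := sing _ K0K; last by move: K0A; rewrite z mul0mx eqxx.
  suff : A *m M i0 = 0.
    move=> z; case/negP: (M_neq0 i0); apply/eqP.
    by rewrite -[M i0](mulKmx Au) z mulmx0.
  apply: KsI => K KK; rewrite mulmxA.
  have [i [Mi|->] ei] := sing _ KK; last by rewrite !mul0mx.
  case: (eqVneq i i0) => [<- //|/M_unit].
  by rewrite (negbTE Mi) (negbTE Mi0).
(* Now [B] is nonzero and singular, so [b] below spans the column space of [B^T]. *)
have [D BD] : exists D : 'cV_2, B^T *m D != 0.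
  apply: contrapT => h; move/eqP: B0; apply; apply: trmx_inj; rewrite trmx0.
  apply/matrixP=> i j; rewrite mxE.
  have : B^T *m delta_mx j 0 = 0 :> 'cV_2.
    by apply/eqP/negPn/negP => hj; apply: h; exists (delta_mx j 0).
  by rewrite -colE => /colP/(_ i); rewrite !mxE.
set b := B^T *m D in BD.
have exb K i : excluded (K *m A) B i -> (K *m A) *m (M i *m b) = 0.
  by rewrite /excluded /b => h; rewrite !mulmxA h mul0mx.
(* If [b] is killed by [M i], so is all of [B^T]: state [i] is excluded before [A], which is
   invertible, acts. *)
have [[i Mib]|nz] := pselect (exists i, M i *m b = 0).
  right; exists i; rewrite ?Au // /excluded -mulmxA.
  rewrite (singular_factor_r _ BD) ?mulmx0 ?unitmx_tr //.
have {}nz i : M i *m b != 0 by apply/eqP => h; apply: nz; exists i.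
exfalso.
(* The vectors [M i *m b] are now all nonzero, and every nonzero [K *m A] kills
   two of them, which are then parallel; since no single pair is killed by all
   the [K *m A], the four vectors split into two parallel pairs. *)
have pairs K : K \in Ks -> exists i j, [/\ i != j, K *m A *m (M i *m b) = 0 & K *m A *m (M j *m b) = 0].
  move=> KK; case: (KsP K KK) => [[i [j [ij /exb ei /exb ej]]]|[i _]]; first by exists i, j.
  by rewrite unitmx_mul (negbTE (Ksing _ KK)) (negbTE Bu).
have [K KK KA] := inj A A0.
have [i [j [ij Ki Kj]]] := pairs K KK.
have pij := singular_par KA Ki Kj.
(* [jointly_injective] speaks of square matrices, so the column is padded with a zero column. The
   [K'] obtained spares [i], hence also the parallel [j], so its pair is disjoint from theirs. *)
have Av : A *m (M i *m b) *m delta_mx 0 0 != 0 :> 'M_2.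
  apply: contra_neq (nz i) => /(congr1 (mulmx^~ (delta_mx 0 0 : 'cV_2))).
  rewrite -mulmxA mul_delta_mx mul0mx => h.
  have {}h : A *m (M i *m b) = 0.
    by rewrite -[LHS]mulmx1 -h; congr (_ *m _); apply/matrixP=> x y; rewrite !ord1 !mxE.
  by rewrite -[LHS](mulKmx Au) h mulmx0.
have [K' KK' K'v] := inj _ Av.
have K'i : K' *m A *m (M i *m b) != 0.
  by apply: contra_neq K'v => h; rewrite !mulmxA in h *; rewrite h mul0mx.
have K'j : K' *m A *m (M j *m b) != 0.
  have [c ec] := par_scale (nz j) pij.
  by apply: contra_neq K'i => h; rewrite ec -scalemxAr h scaler0.
have [k [l [kl Kk Kl]]] := pairs K' KK'.
have K'A : K' *m A != 0 by apply: contra_neq K'i => ->; rewrite mul0mx.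
have pkl := singular_par K'A Kk Kl.
have := M_par _ pij pkl.
have ne x y : K' *m A *m (M x *m b) != 0 -> K' *m A *m (M y *m b) = 0 -> x != y.
  by move=> hx hy; apply: contra_neq hx => ->.
move=> /(_ _)/eqP; rewrite (negbTE BD) => /(_ _)/notF; apply.
by rewrite /= !inE !negb_or ij kl !ne.
Qed.

End Exclusion.

(** * Explicit 2 x 2 matrices and the amplitude matrices of the four states *)

Definition mx22 (K : nzRingType) (a b c d : K) : 'M[K]_2 :=
  \matrix_(i, j) if i == 0 then (if j == 0 then a else b)
                 else (if j == 0 then c else d).

Lemma mx22_eta (K : nzRingType) (A : 'M[K]_2) :
  A = mx22 (A 0 0) (A 0 1) (A 1 0) (A 1 1).
Proof.
have I2 (i : 'I_2) : i = 0 \/ i = 1.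
  by case: i => [[|[|//]]] p; [left|right]; apply/val_inj.
by apply/matrixP=> i j; rewrite mxE; case: (I2 i) (I2 j) => -> [] ->.
Qed.

Lemma tr_mx22 (K : nzRingType) (a b c d : K) : (mx22 a b c d)^T = mx22 a c b d.
Proof. by rewrite [LHS]mx22_eta !mxE. Qed.

Lemma det_mx22 (K : comNzRingType) (a b c d : K) :
  \det (mx22 a b c d) = a * d - b * c.
Proof.
rewrite (expand_det_row _ 0) !big_ord_recl big_ord0 /cofactor !det_mx11 !mxE /=.
by rewrite addr0 addn0 expr0 expr1; ring.
Qed.

Lemma sum2 (V : nmodType) (f : 'I_2 -> V) : \sum_i f i = f 0 + f 1.
Proof.
rewrite !big_ord_recl big_ord0 addr0; congr (_ + f _); exact: val_inj.
Qed.

Section Family.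
Variable K : comNzRingType.

(* For [e = 1] these are the amplitude matrices of the four states, with [c, s]
   and [c', s'] the cosines and sines of the two angles and [r] the norming
   factor; transposing them amounts to exchanging [c'] and [s'] and negating
   [e]. *)
Definition family (e r c s c' s' : K) (i : 'I_4) : 'M[K]_2 :=
  match val i with
  | 0 => mx22 c 0 0 (- s)
  | 1 => mx22 0 (e * c') (- (e * s')) 0
  | 2 => mx22 (r * s) (r * s') (r * c') (r * c)
  | _ => mx22 (r * s) (- (r * s')) (- (r * c')) (r * c)
  end.

Lemma tr_family e r c s c' s' i :
  (family e r c s c' s' i)^T = family (- e) r c s s' c' i.
Proof.
by case: i => [[|[|[|[|//]]]]] p; rewrite /family /= tr_mx22 //; congr mx22; ring.
Qed.
End Family.

(** * The algebraic conditions on the angles and what they imply for the family *)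

Section Generic.
Variable F : fieldType.

(* The last two conditions are automatic over the reals; in an extension they
   exclude that the two quantities are square roots of -1. *)
Record generic (c s c' s' : F) : Prop := Generic {
  generic_norm : c ^+ 2 + s ^+ 2 = 1;
  generic_norm' : c' ^+ 2 + s' ^+ 2 = 1;
  generic_sinB : c * s' - s * c' != 0;
  generic_cosD : c * c' - s * s' != 0;
  generic_sinD : c * s' + s * c' != 0;
  generic_cosB : c * c' + s * s' != 0;
  generic_sinB_i : (c * s' - s * c') ^+ 2 + 1 != 0;
  generic_cosD_i : (c * c' - s * s') ^+ 2 + 1 != 0 }.

(** Passing to the complement of the second angle exchanges the conditions in pairs. With
    [tr_family], it makes results on the family available for the transposed family. *)
Lemma generic_swap c s c' s' : generic c s c' s' -> generic c s s' c'.
Proof. by case=> *; split=> //; rewrite addrC. Qed.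

Variables e r c s c' s' : F.
Hypotheses (two0 : 2 != 0 :> F) (e0 : e != 0) (r0 : r != 0) (G : generic c s c' s').
Local Notation M := (family e r c s c' s').

(** The last two determinants equal [r^2 (s c - s' c')], where [s c - s' c'] is the product of
    sin(al - be) and cos(al + be). The first two are [- s c] and [e^2 s' c'], which cannot both
    vanish for the same reason. *)
Lemma family_unit i j : i != j -> (M i \in unitmx) || (M j \in unitmx).
Proof.
have D : s * c - s' * c' = (s * c' - s' * c) * (c * c' - s * s').
  have h : s * c - s' * c' = s * c * (c' ^+ 2 + s' ^+ 2) - s' * c' * (c ^+ 2 + s ^+ 2).
    by rewrite (generic_norm G) (generic_norm' G) !mulr1.
  by rewrite h; ring.
have D0 : s * c - s' * c' != 0.
  rewrite D mulf_neq0 ?(generic_cosD G) //.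
  have -> : s * c' - s' * c = - (c * s' - s * c') by ring.
  by rewrite oppr_eq0 (generic_sinB G).
have U2 : M (inord 2) \in unitmx.
  rewrite unitmxE unitfE /family /= inordK // det_mx22.
  by apply: contra_neq (mulf_neq0 (expf_neq0 2 r0) D0) => <-; ring.
have U3 : M (inord 3) \in unitmx.
  rewrite unitmxE unitfE /family /= inordK // det_mx22.
  by apply: contra_neq (mulf_neq0 (expf_neq0 2 r0) D0) => <-; ring.
have U01 : (M (inord 0) \in unitmx) || (M (inord 1) \in unitmx).
  rewrite !unitmxE !unitfE /family /= !inordK // !det_mx22 -negb_and.
  apply: contra D0 => /andP[/eqP h0 /eqP h1]; apply/eqP.
  have a : s * c = 0 by move: h0; rewrite mul0r subr0 mulrN => /eqP; rewrite oppr_eq0 mulrC => /eqP.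
  have b : s' * c' = 0.
    apply: (mulfI (expf_neq0 2 e0)); rewrite mulr0 -h1; ring.
  by rewrite a b subr0.
move: U2 U3 U01; rewrite /family /= !inordK //= => U2 U3 U01.
case: i => [[|[|[|[|//]]]]] p; case: j => [[|[|[|[|//]]]]] q //= _;
  by rewrite ?U2 ?U3 ?orbT // orbC.
Qed.

(** Up to nonzero factors, each matrix has both the cosine and the sine of one of the angles among
    its entries. *)
Lemma family_neq0 i : M i != 0.
Proof.
have cs x y : x ^+ 2 + y ^+ 2 = 1 :> F -> ~ (x = 0 /\ y = 0).
  by move=> h [x0 y0]; move/eqP: h; rewrite x0 y0 expr0n addr0 eq_sym oner_eq0.
apply/eqP => Z; have Zij a b : M i a b = 0 by rewrite Z mxE.
move: (Zij 0 0) (Zij 0 1) (Zij 1 0) (Zij 1 1).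
have eI x : e * x = 0 -> x = 0 by move/eqP; rewrite mulf_eq0 (negbTE e0) => /eqP.
have rI x : r * x = 0 -> x = 0 by move/eqP; rewrite mulf_eq0 (negbTE r0) => /eqP.
have nI x : - x = 0 -> x = 0 :> F by move/eqP; rewrite oppr_eq0 => /eqP.
case: i {Z Zij} => [[|[|[|[|//]]]]] p; rewrite /family /= !mxE /=.
- by move=> c0 _ _ /nI s0; apply: (cs _ _ (generic_norm G)).
- by move=> _ /eI c0 /nI/eI s0 _; apply: (cs _ _ (generic_norm' G)).
- by move=> /rI s0 _ _ /rI c0; apply: (cs _ _ (generic_norm G)).
- by move=> /rI s0 _ _ /rI c0; apply: (cs _ _ (generic_norm G)).
Qed.

Lemma eq_rescale (k a b a' b' : F) :
  k != 0 -> k * (a - b) = a' - b' -> a' = b' -> a = b.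
Proof.
move=> k0 h ab; apply/eqP; rewrite -subr_eq0; move/eqP: h.
by rewrite ab subrr mulf_eq0 (negbTE k0).
Qed.

(** The sum of the equations is [(c c' + s s') (x^2 + y^2) = 0], so [y^2 = - x^2]. The first
    equation becomes [(c c' - s s') x^2 = - x y], and squaring it gives
    [((c c' - s s')^2 + 1) x^4 = 0]. *)
Lemma generic_quadrics (x y : F) :
  c * c' * x ^+ 2 + x * y + s * s' * y ^+ 2 = 0 ->
  c * c' * y ^+ 2 - x * y + s * s' * x ^+ 2 = 0 -> x = 0 /\ y = 0.
Proof.
move=> h1 h2.
have xy : x ^+ 2 + y ^+ 2 = 0.
  apply: (mulfI (generic_cosB G)); rewrite mulr0.
  by rewrite -[RHS](addr0 0) -[X in _ = X + _]h1 -h2; ring.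
have h' : (c * c' - s * s') * x ^+ 2 = - (x * y).
  apply/eqP; rewrite -addr_eq0; apply/eqP; rewrite -[RHS]h1.
  by rewrite -[RHS]subr0 -[X in _ = _ - X](mulr0 (s * s')) -xy; ring.
have y2 : y ^+ 2 = - x ^+ 2 by apply/eqP; rewrite -addr_eq0 addrC xy.
have : ((c * c' - s * s') ^+ 2 + 1) * x ^+ 4 = 0.
  have -> : ((c * c' - s * s') ^+ 2 + 1) * x ^+ 4
    = ((c * c' - s * s') * x ^+ 2) ^+ 2 + x ^+ 4 by ring.
  rewrite h'; have -> : (- (x * y)) ^+ 2 = x ^+ 2 * y ^+ 2 by ring.
  by rewrite y2; ring.
move/eqP; rewrite mulf_eq0 (negbTE (generic_cosD_i G)) /= expf_eq0 /= => /eqP x0.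
split=> //; have : y ^+ 2 == 0 by rewrite y2 x0 expr0n oppr0.
by rewrite expf_eq0 /= => /eqP.
Qed.

(** The two conditions are linear in [x^2] and [y^2], with determinant [(c s')^2 - (s c')^2] up to
    sign and nonzero factors. *)
Lemma family_par_01_23 (b : 'cV[F]_2) i j k l :
  [:: val i; val j; val k; val l] = [:: 0; 1; 2; 3]%N ->
  par (M i *m b) (M j *m b) -> par (M k *m b) (M l *m b) -> b = 0.
Proof.
case=> hi hj hk hl; rewrite /family /= hi hj hk hl /par !mxE !sum2 !mxE /=.
set x := b 0 0; set y := b 1 0 => h1 h2.
have {}h1 : s * c' * y ^+ 2 = c * s' * x ^+ 2.
  by apply: (eq_rescale e0) h1; ring.
have {}h2 : c * s' * y ^+ 2 = s * c' * x ^+ 2.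
  by apply: (eq_rescale (mulf_neq0 two0 (expf_neq0 2 r0))) h2; ring.
have D0 : (c * s' - s * c') * (c * s' + s * c') != 0.
  by rewrite mulf_neq0 ?(generic_sinB G) ?(generic_sinD G).
have x0 : x ^+ 2 = 0.
  apply: (mulfI D0); rewrite mulr0.
  transitivity (c * s' * (c * s' * x ^+ 2) - s * c' * (s * c' * x ^+ 2)); first by ring.
  by rewrite -h1 -h2; ring.
have y0 : y ^+ 2 = 0.
  apply: (mulfI D0); rewrite mulr0.
  transitivity (c * s' * (c * s' * y ^+ 2) - s * c' * (s * c' * y ^+ 2)); first by ring.
  by rewrite h1 h2; ring.
move/eqP: x0; move/eqP: y0; rewrite !expf_eq0 /= => /eqP y0 /eqP x0.
by apply: cV2P; rewrite mxE.
Qed.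

(** The coefficients of [x y] are the two squared norms, up to sign and nonzero factors; replacing
    them by 1 leaves the equations of [generic_quadrics]. *)
Lemma family_par_02_13 (b : 'cV[F]_2) i j k l :
  [:: val i; val j; val k; val l] = [:: 0; 2; 1; 3]%N ->
  par (M i *m b) (M j *m b) -> par (M k *m b) (M l *m b) -> b = 0.
Proof.
case=> hi hj hk hl; rewrite /family /= hi hj hk hl /par !mxE !sum2 !mxE /=.
set x := b 0 0; set y := b 1 0 => h1 h2.
have [x0 y0] : x = 0 /\ y = 0; last by apply: cV2P; rewrite mxE.
apply: generic_quadrics.
  rewrite -[x * y]mul1r -(generic_norm G).
  by apply: (eq_rescale r0) h1; ring.
rewrite -[x * y]mul1r -(generic_norm' G).
by apply: (eq_rescale (mulf_neq0 e0 r0)) h2; ring.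
Qed.

(** Changing the sign of [y] leads back to the preceding pairing. *)
Lemma family_par_03_12 (b : 'cV[F]_2) i j k l :
  [:: val i; val j; val k; val l] = [:: 0; 3; 1; 2]%N ->
  par (M i *m b) (M j *m b) -> par (M k *m b) (M l *m b) -> b = 0.
Proof.
case=> hi hj hk hl; rewrite /family /= hi hj hk hl /par !mxE !sum2 !mxE /=.
set x := b 0 0; set y := b 1 0 => h1 h2.
have [x0 /eqP] : x = 0 /\ - y = 0; last first.
  by rewrite oppr_eq0 => /eqP y0; apply: cV2P; rewrite mxE.
have r0' : - r != 0 by rewrite oppr_eq0.
apply: generic_quadrics.
  rewrite -[x * - y]mul1r -(generic_norm G).
  by apply: (eq_rescale r0') h1; ring.
rewrite -[x * - y]mul1r -(generic_norm' G).
by apply: (eq_rescale (mulf_neq0 e0 r0)) h2; ring.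
Qed.

Lemma family_par (i j k l : 'I_4) (b : 'cV[F]_2) : uniq [:: i; j; k; l] ->
  par (M i *m b) (M j *m b) -> par (M k *m b) (M l *m b) -> b = 0.
Proof.
have P := @family_par_01_23 b; have Q := @family_par_02_13 b.
have T := @family_par_03_12 b.
(* The 24 orderings are the three pairings treated above, each in the eight orders obtained by
   swapping within the pairs and swapping the pairs. *)
move=> U h1 h2; have h3 := par_sym h1; have h4 := par_sym h2; move: U h1 h2 h3 h4.
let go h h' := first [by apply: (P _ _ _ _ _ h h') | by apply: (Q _ _ _ _ _ h h')
                     | by apply: (T _ _ _ _ _ h h')] in
case: i => [[|[|[|[|//]]]]] pi; case: j => [[|[|[|[|//]]]]] pj //=;
case: k => [[|[|[|[|//]]]]] pk //=; case: l => [[|[|[|[|//]]]]] pl //= _ h1 h2 h3 h4;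
first [go h1 h2 | go h1 h4 | go h3 h2 | go h3 h4
      | go h2 h1 | go h2 h3 | go h4 h1 | go h4 h3].
Qed.

End Generic.

(** Transposing [A *m M i *m B^T] exchanges the parties, so only Alice's step has to be proved
    directly. *)
Lemma excluding_tr (F : fieldType) (M : 'I_4 -> 'M[F]_2) A B :
  excluding M A B -> excluding (fun i => (M i)^T) B A.
Proof.
have ex i : excluded M A B i -> excluded (fun i => (M i)^T) B A i.
  by move=> /(congr1 trmx); rewrite !trmx_mul trmxK trmx0 mulmxA.
case=> [[i [j [ij /ex ei /ex ej]]]|[i /ex ei h]].
  by left; exists i, j.
by right; exists i; rewrite // orbC.
Qed.

(** * One-copy protocols in terms of amplitude matrices *)

Section Protocols.
Variable R : realType.
Local Notation C := R[i].

Lemma instrument_injective (Ks : seq (M2 R)) :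
  instrument Ks -> jointly_injective Ks.
Proof.
move=> KsI X KX; rewrite -[X]mul1mx -KsI mulmx_suml big1_seq // => K /andP[_ KK].
by rewrite -mulmxA KX // mulmx0.
Qed.

Definition amplitudes (psi : ket2 R) : M2 R :=
  \matrix_(i, j) psi (mxtens_index (i, j)) 0.

Lemma amplitudes_mul (A B : M2 R) (psi : ket2 R) :
  amplitudes ((A *t B) *m psi) = A *m amplitudes psi *m B^T.
Proof.
apply/matrixP=> i j; rewrite !mxE.
rewrite (reindex (@mxtens_index 2 2)) /=; last first.
  by exists (@mxtens_unindex 2 2) => k _; [exact: mxtens_indexK|exact: mxtens_unindexK].
transitivity (\sum_k \sum_l (A *t B) (mxtens_index (i, j)) (mxtens_index (k, l))
    * psi (mxtens_index (k, l)) 0).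
  by rewrite pair_bigA; apply: eq_bigr => -[k l].
rewrite exchange_big /=.
apply: eq_bigr => l _; rewrite !mxE big_distrl /=; apply: eq_bigr => k _.
by rewrite tensmxE !mxE; ring.
Qed.

Lemma amplitudes_eq0 (psi : ket2 R) : (amplitudes psi == 0) = (psi == 0).
Proof.
apply/eqP/eqP => [Z|->]; last by apply/matrixP=> i j; rewrite !mxE.
apply/matrixP=> x y; rewrite ord1 -(mxtens_unindexK x).
case: (mxtens_unindex x) => i j.
by have := congr1 (fun A : 'M_2 => A i j) Z; rewrite !mxE.
Qed.

Lemma reachesE l psi : reaches l psi = (l.1 *m amplitudes psi *m l.2^T != 0).
Proof. by rewrite /reaches -amplitudes_eq0 amplitudes_mul. Qed.

(** Induction on the protocol: undoing its last instrument keeps [excluding] true at all leaves,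
    down to the root, which excludes nothing because no [M i] vanishes. The condition on the
    transposes serves Bob's instruments. *)
Lemma LOCC_no_double_exclusion (M : 'I_4 -> 'M[C]_2) (s : seq (M2 R * M2 R)) :
  (forall i, M i != 0) ->
  (forall i j, i != j -> (M i \in unitmx) || (M j \in unitmx)) ->
  (forall (i j k l : 'I_4) (b : 'cV[C]_2), uniq [:: i; j; k; l] ->
    par (M i *m b) (M j *m b) -> par (M k *m b) (M l *m b) -> b = 0) ->
  (forall (i j k l : 'I_4) (b : 'cV[C]_2), uniq [:: i; j; k; l] ->
    par ((M i)^T *m b) ((M j)^T *m b) -> par ((M k)^T *m b) ((M l)^T *m b) ->
    b = 0) ->
  LOCC s ->
  ~ (forall l, l \in s -> exists i j, [/\ i != j, excluded M l.1 l.2 i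
                                        & excluded M l.1 l.2 j]).
Proof.
move=> M0 MU MP MPT Ls sP.
have {sP} : forall l, l \in s -> excluding M l.1 l.2 by move=> l /sP; left.
elim: Ls => [sP|s1 A B s2 Ks _ IH KsI sP|s1 A B s2 Ks _ IH KsI sP].
- have ne i : ~ excluded M 1%:M 1%:M i.
    by rewrite /excluded mul1mx trmx1 mulmx1; apply/eqP.
  by case: (sP _ (mem_head _ _)) => [[i [j [_ /ne]]]|[i /ne]].
- apply: IH => l; rewrite mem_cat inE => /or3P[h|/eqP -> /=|h].
  + by apply: sP; rewrite mem_cat h.
  + apply: (excluding_Alice M0 MU MP (instrument_injective KsI)) => K KK.
    by apply: (sP (K *m A, B)); rewrite !mem_cat (map_f (fun K => (K *m A, B))) ?orbT.
  + by apply: sP; rewrite !mem_cat h !orbT.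
- apply: IH => l; rewrite mem_cat inE => /or3P[h|/eqP -> /=|h].
  + by apply: sP; rewrite mem_cat h.
  (* [excluding_tr] is applied twice, to the transposed family and back; hence the double
     transpose. *)
  + have -> : M = (fun i => ((M i)^T)^T) by apply/funext => i; rewrite trmxK.
    apply: excluding_tr.
    have M0' i : (M i)^T != 0 by rewrite -(trmx0 C 2 2) (inj_eq (@trmx_inj _ _ _)).
    have MU' i j : i != j -> ((M i)^T \in unitmx) || ((M j)^T \in unitmx).
      by rewrite !unitmx_tr; apply: MU.
    apply: (excluding_Alice M0' MU' MPT (instrument_injective KsI)) => K KK.
    apply: excluding_tr.
    by apply: (sP (A, K *m B)); rewrite !mem_cat (map_f (fun K => (A, K *m B))) ?orbT.
  + by apply: sP; rewrite !mem_cat h !orbT.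
Qed.

Lemma amplitudesD (p q : ket2 R) : amplitudes (p + q) = amplitudes p + amplitudes q.
Proof. by apply/matrixP=> i j; rewrite !mxE. Qed.

Lemma amplitudesN (p : ket2 R) : amplitudes (- p) = - amplitudes p.
Proof. by apply/matrixP=> i j; rewrite !mxE. Qed.

Lemma amplitudesZ a (p : ket2 R) : amplitudes (a *: p) = a *: amplitudes p.
Proof. by apply/matrixP=> i j; rewrite !mxE. Qed.

Lemma amplitudes_ket a b : amplitudes (ket R a b) = delta_mx a b.
Proof.
apply/matrixP=> i j; rewrite mxE /ket.
have := tensmxE (ket1 R a) (ket1 R b) i j 0 0.
rewrite (_ : mxtens_index (0, 0) = 0); last exact/val_inj.
by move=> ->; rewrite !mxE !eqxx !andbT -natrM mulnb.
Qed.

Lemma amplitudes_basis_state (al be : R) i :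
  amplitudes (basis_state al be i) =
  map_mx (@r2c R) (family 1 (Num.sqrt 2)^-1 (cos al) (sin al) (cos be) (sin be) i).
Proof.
have mapE (a b c d : R) : map_mx (@r2c R) (mx22 a b c d)
    = mx22 (r2c a) (r2c b) (r2c c) (r2c d).
  by rewrite [LHS]mx22_eta !mxE.
have deltaE a b : delta_mx a b = mx22 ((a == 0) && (b == 0))%:R
   ((a == 0) && (b == 1))%:R ((a == 1) && (b == 0))%:R ((a == 1) && (b == 1))%:R :> M2 R.
  by rewrite [LHS]mx22_eta !mxE ![_ == a]eq_sym ![_ == b]eq_sym.
have addE (a b c d a' b' c' d' : C) :
    mx22 a b c d + mx22 a' b' c' d' = mx22 (a + a') (b + b') (c + c') (d + d').
  by rewrite [LHS]mx22_eta !mxE.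
have oppE (a b c d : C) : - mx22 a b c d = mx22 (- a) (- b) (- c) (- d).
  by rewrite [LHS]mx22_eta !mxE.
have scaleE (k a b c d : C) : k *: mx22 a b c d = mx22 (k * a) (k * b) (k * c) (k * d).
  by rewrite [LHS]mx22_eta !mxE.
have ampE a b a' b' (x y : C) : amplitudes (x *: ket R a b + y *: ket R a' b')
    = x *: delta_mx a b + y *: delta_mx a' b'.
  by rewrite amplitudesD !amplitudesZ !amplitudes_ket.
have ampNE a b a' b' (x y : C) : amplitudes (x *: ket R a b - y *: ket R a' b')
    = x *: delta_mx a b - y *: delta_mx a' b'.
  by rewrite amplitudesD amplitudesN !amplitudesZ !amplitudes_ket.
have amp4E a b a' b' c d c' d' (z x y x' y' : C) :
    amplitudes (z *: ((x *: ket R a b + y *: ket R a' b')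
                      + (x' *: ket R c d + y' *: ket R c' d')))
    = z *: (x *: delta_mx a b + y *: delta_mx a' b'
            + (x' *: delta_mx c d + y' *: delta_mx c' d')).
  by rewrite amplitudesZ amplitudesD; congr (_ *: (_ + _)); apply: ampE.
have amp4NE a b a' b' c d c' d' (z x y x' y' : C) :
    amplitudes (z *: ((x *: ket R a b + y *: ket R a' b')
                      - (x' *: ket R c d + y' *: ket R c' d')))
    = z *: (x *: delta_mx a b + y *: delta_mx a' b'
            - (x' *: delta_mx c d + y' *: delta_mx c' d')).
  by rewrite amplitudesZ amplitudesD amplitudesN; congr (_ *: (_ - _)); apply: ampE.
have r0 : r2c 0 = 0 :> C by [].
have r1 : r2c 1 = 1 :> C by [].
have rM x y : r2c (x * y) = r2c x * r2c y :> C by rewrite /r2c rmorphM.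
have rN x : r2c (- x) = - r2c x :> C by rewrite /r2c rmorphN.
rewrite /basis_state /phi_p /phi_m /psi_p /psi_m /family.
move: (cos al) (sin al) (cos be) (sin be) (Num.sqrt 2)^-1 => c s c' s' r.
case: i => [[|[|[|[|//]]]]] p /=.
1,2: rewrite ampNE.
3: rewrite amp4E.
4: rewrite amp4NE.
all: rewrite !deltaE /= !scaleE ?(oppE, addE).
all: rewrite ?(scaleE, addE, oppE) mapE ?(rM, rN, r0, r1).
all: by congr mx22; ring.
Qed.
End Protocols.

(** Field morphisms are injective, so the conditions can be checked over the reals and used over the
    complex numbers. *)
Lemma generic_map (F F' : fieldType) (f : {rmorphism F -> F'}) (c s c' s' : F) :
  generic c s c' s' -> generic (f c) (f s) (f c') (f s').
Proof.
by case=> h1 h2 h3 h4 h5 h6 h7 h8; split;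
  rewrite -?(rmorphM, rmorphXn) -?rmorphD -?rmorphB -?rmorphXn
    -?[1](rmorph1 f) -?rmorphD ?fmorph_eq0 ?h1 ?h2.
Qed.

Lemma map_family (K K' : comNzRingType) (f : {rmorphism K -> K'}) e r c s c' s' i :
  map_mx f (family e r c s c' s' i)
  = family (f e) (f r) (f c) (f s) (f c') (f s') i.
Proof.
rewrite [LHS]mx22_eta; case: i => [[|[|[|[|//]]]]] p; rewrite /family /= !mxE /=;
  by rewrite ?rmorphN ?rmorphM ?rmorph0.
Qed.

Lemma family_orthogonal (K : comNzRingType) (r c s c' s' : K) i j :
  c ^+ 2 + s ^+ 2 = 1 -> c' ^+ 2 + s' ^+ 2 = 1 -> i != j ->
  \tr (family 1 r c s c' s' i *m (family 1 r c s c' s' j)^T) = 0.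
Proof.
move=> h h'; rewrite /mxtrace sum2 !mxE !sum2 !mxE.
case: i => [[|[|[|[|//]]]]] pi; case: j => [[|[|[|[|//]]]]] pj //= _;
  rewrite /family /= !mxE /=; try ring.
(* Only the last two states are left: their inner product is the difference of two squared norms. *)
all: transitivity (r ^+ 2 * (c ^+ 2 + s ^+ 2 - (c' ^+ 2 + s' ^+ 2))); first ring.
all: by rewrite h h' subrr mulr0.
Qed.

(** * The hypotheses on the angles give the algebraic conditions *)

Section Angles.
Variable R : realType.

Lemma sin_neq0 (x : R) : x != 0 -> - pi < x < pi -> sin x != 0.
Proof.
move=> x0 /andP[l u]; case: (ltrgt0P x) x0 => [p|n|//] _.
  by rewrite gt_eqF // sin_gt0_pi // p u.
by rewrite -oppr_eq0 -sinN gt_eqF // sin_gt0_pi // oppr_gt0 n /= ltrNl l.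
Qed.

(** In the given square, sin(al - be) vanishes only for equal angles and cos(al + be) only for
    complementary ones. The zeros of sin(al + be) and cos(al - be) are corners of the square, where
    the angles are respectively equal and complementary. *)
Lemma generic_angles (al be : R) :
  0 <= al <= pi / 2 -> 0 <= be <= pi / 2 -> al != be -> al != pi / 2 - be ->
  generic (cos al) (sin al) (cos be) (sin be).
Proof.
move=> /andP[a0 a1] /andP[b0 b1] ab ab'; have pi0 := pi_gt0 R.
have sqr1 (x : R) : x ^+ 2 + 1 != 0 by rewrite gt_eqF // ltr_wpDl ?sqr_ge0.
split; rewrite ?sqr1 ?cos2Dsin2 //.
- rewrite -oppr_eq0 opprB [cos al * _]mulrC [X in X - _]mulrC -[_ - _]addrC.
  have -> : - (sin be * cos al) + cos be * sin al = sin (al - be).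
    by rewrite sinB; ring.
  by apply: sin_neq0; [rewrite subr_eq0|apply/andP; split; lra].
- rewrite -cosD -oppr_eq0 -sinBpihalf; apply: sin_neq0.
    by apply: contra_neq ab' => h; lra.
  by apply/andP; split; lra.
- rewrite addrC -sinD; apply: sin_neq0; last first.
    apply/andP; split; first lra.
    rewrite lt_neqAle; apply/andP; split; last lra.
    by apply: contra_neq ab => h; lra.
  by apply: contra_neq ab => h; lra.
- rewrite -cosB gt_eqF // cos_gt0_pihalf //; apply/andP; split.
    rewrite lt_neqAle; apply/andP; split; last lra.
    by apply: contra_neq ab' => h; lra.
  rewrite lt_neqAle; apply/andP; split; last lra.
  by apply: contra_neq ab' => h; lra.
Qed.
End Angles.

(** * Two copies do not suffice *)

Section LowerBound.
Variables (R : realType) (al be : R).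
Hypothesis G : generic (cos al) (sin al) (cos be) (sin be).
Local Notation st := (basis_state al be).

Lemma basis_no_double_exclusion s : LOCC s ->
  ~ (forall l, l \in s ->
       exists i j, [/\ i != j, ~~ reaches l (st i) & ~~ reaches l (st j)]).
Proof.
move=> Ls sP.
pose f := real_complex R; pose r : R := (Num.sqrt 2)^-1.
pose Mat e c' s' := family e (f r) (f (cos al)) (f (sin al)) (f c') (f s').
have stE i : amplitudes (st i) = Mat (f 1) (cos be) (sin be) i.
  by rewrite amplitudes_basis_state /Mat -map_family.
have r0 : f r != 0 by rewrite fmorph_eq0 invr_eq0 sqrtr_eq0 -ltNge ltr0n.
have two0 : 2 != 0 :> R[i] by rewrite pnatr_eq0.
have e0 : f 1 != 0 by rewrite fmorph_eq0 oner_eq0.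
have GC := generic_map f G.
have Ne0 : - f 1 != 0 by rewrite oppr_eq0.
apply: (LOCC_no_double_exclusion (family_neq0 e0 r0 GC)
  (family_unit e0 r0 GC) (family_par two0 e0 r0 GC) _ Ls) => [i j k l b|l /sP].
  rewrite !tr_family; exact: (family_par two0 Ne0 r0 (generic_swap GC)).
move=> [i [j [ij hi hj]]]; exists i, j; split=> //; rewrite /excluded.
  by move: hi; rewrite reachesE negbK stE => /eqP.
by move: hj; rewrite reachesE negbK stE => /eqP.
Qed.

Lemma not_adaptive_ok0 : ~ adaptive_ok st 0 [set: 'I_4].
Proof. by move=> /(_ 0 1); rewrite !inE => /(_ isT isT). Qed.

(** Each leaf of the last copy may keep at most one candidate; starting from three, it would have to
    exclude two. *)
Lemma adaptive_ok1_card (S : {set 'I_4}) : adaptive_ok st 1 S -> (#|S| <= 2)%N.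
Proof.
move=> [s [Ls sP]]; rewrite leqNgt; apply/negP => S3.
apply: (basis_no_double_exclusion Ls) => l /sP /= lP.
have : (1 < #|[set i in S | ~~ reaches l (st i)]|)%N.
  have le1 : (#|[set i in S | reaches l (st i)]| <= 1)%N.
    by apply/card_le1_eqP => i j hi hj; apply: lP.
  have := cardsID [set i | reaches l (st i)] S.
  have -> : S :&: [set i | reaches l (st i)] = [set i in S | reaches l (st i)].
    by apply/setP => i; rewrite !inE.
  have -> : S :\: [set i | reaches l (st i)] = [set i in S | ~~ reaches l (st i)].
    by apply/setP => i; rewrite !inE andbC.
  by move: le1 S3; case: #|_| => [|[|//]] _ + h; rewrite -h ?add0n ?add1n // => /ltnW.
move/card_gt1P => [i [j []]]; rewrite !inE => /andP[_ hi] /andP[_ hj] ij.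
by exists i, j.
Qed.

(** Each leaf of the first copy must leave at most two candidates to the second, hence exclude two
    of the four. *)
Lemma not_adaptive_ok2 : ~ adaptive_ok st 2 [set: 'I_4].
Proof.
move=> [s [Ls sP]]; apply: (basis_no_double_exclusion Ls) => l /sP.
move=> /adaptive_ok1_card h.
have : (1 < #|~: [set i in [set: 'I_4] | reaches l (st i)]|)%N.
  by rewrite cardsCs finset.setCK card_ord; move: h; case: #|_| => [|[|[|]]].
move/card_gt1P => [i [j []]]; rewrite !inE /= => hi hj ij.
by exists i, j.
Qed.
End LowerBound.

(** * Pairwise separation by projective measurements along real directions *)

Section UpperBound.
Variable R : realType.

Lemma unit_direction (x y : R) : (x != 0) || (y != 0) ->
  exists u v t, [/\ u ^+ 2 + v ^+ 2 = 1, x = t * u, y = t * v & t != 0].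
Proof.
move=> xy0; have p : 0 < x ^+ 2 + y ^+ 2.
  by rewrite lt0r addr_ge0 ?sqr_ge0 // andbT paddr_eq0 ?sqr_ge0 // !expf_eq0 /= negb_and.
set t := Num.sqrt (x ^+ 2 + y ^+ 2).
have t0 : t != 0 by rewrite gt_eqF // sqrtr_gt0.
exists (x / t), (y / t), t; split=> //; [|by field|by field].
rewrite !expr_div_n -mulrDl sqr_sqrtr ?ltW // divff // gt_eqF //.
Qed.

Lemma isotropic_direction (p q : R) : exists u v,
  u ^+ 2 + v ^+ 2 = 1 /\ p * (u ^+ 2 - v ^+ 2) + q * (u * v) *+ 2 = 0.
Proof.
have [->|p0] := eqVneq p 0.
  by exists 1, 0; split; ring.
set w := Num.sqrt (q ^+ 2 + p ^+ 2).
have w2 : w ^+ 2 = q ^+ 2 + p ^+ 2 by rewrite sqr_sqrtr // addr_ge0 ?sqr_ge0.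
(* [(w - q, p)] is a root of [p x^2 + 2 q x y - p y^2], a form of discriminant [4 w^2]. *)
have [|u [v [t [uv xu yv t0]]]] := @unit_direction (w - q) p; first by rewrite p0 orbT.
exists u, v; split=> //; apply: (mulfI (expf_neq0 2 t0)); rewrite mulr0.
transitivity (p * ((t * u) ^+ 2 - (t * v) ^+ 2) + q * (t * u * (t * v)) *+ 2); first by ring.
rewrite -xu -yv; transitivity (p * (w ^+ 2 - (q ^+ 2 + p ^+ 2))); first by ring.
by rewrite w2 subrr mulr0.
Qed.

(** The direction is orthogonal to the first vector and parallel to the second. In a measurement
    along [(u, v)] and [(- v, u)], the first outcome excludes the first vector and the second
    outcome the second. *)
Lemma separating_direction (x1 y1 x2 y2 : R) : x1 * x2 + y1 * y2 = 0 ->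
  exists u v, [/\ u ^+ 2 + v ^+ 2 = 1, x1 * u + y1 * v = 0 & y2 * u - x2 * v = 0].
Proof.
move=> o.
have dir x y : (x != 0) || (y != 0) -> x1 * x + y1 * y = 0 -> y2 * x - x2 * y = 0 ->
    exists u v, [/\ u ^+ 2 + v ^+ 2 = 1, x1 * u + y1 * v = 0 & y2 * u - x2 * v = 0].
  move=> /unit_direction[u [v [t [uv -> -> t0]]]] h1 h2; exists u, v; split=> //.
    by apply: (mulfI t0); rewrite mulr0 -h1; ring.
  by apply: (mulfI t0); rewrite mulr0 -h2; ring.
have [z1|n1] := boolP ((x1 == 0) && (y1 == 0)).
  case/andP: z1 => /eqP x10 /eqP y10.
  have [z2|n2] := boolP ((x2 == 0) && (y2 == 0)).
    case/andP: z2 => /eqP -> /eqP ->.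
    by exists 1, 0; split; rewrite ?x10 ?y10; ring.
  by apply: (dir x2 y2); rewrite -?negb_and // mulrC subrr.
apply: (dir (- y1) x1); first by rewrite oppr_eq0 orbC -negb_and.
  by ring.
by rewrite -[RHS]oppr0 -o; ring.
Qed.

Definition proj (u v : R) : M2 R :=
  map_mx (real_complex R) (mx22 (u * u) (u * v) (u * v) (v * v)).

Lemma instrument_proj (u v : R) : u ^+ 2 + v ^+ 2 = 1 ->
  instrument [:: proj u v; proj (- v) u].
Proof.
move=> uv; rewrite /instrument !big_cons big_nil addr0.
have PP (x y : R) : x ^+ 2 + y ^+ 2 = 1 -> adj (proj x y) *m proj x y = proj x y.
  move=> xy; have -> : adj (proj x y) = proj x y.
    have conjE (z : R) : Num.conj (real_complex R z) = real_complex R z.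
      exact: conjc_real.
    rewrite /proj -[in RHS]tr_mx22; apply/matrixP => i j.
    rewrite [LHS]mxE [LHS]mxE [X in Num.conj X]mxE [RHS]mxE.
    by rewrite conjE [in RHS]mxE.
  rewrite /proj -map_mxM; congr map_mx; rewrite [LHS]mx22_eta !mxE !sum2 !mxE /=.
  congr mx22; rewrite -[RHS]mul1r -xy; ring.
rewrite !PP //; last by rewrite -uv; ring.
rewrite /proj -map_mxD -(map_mx1 (real_complex R)); congr map_mx.
rewrite [LHS]mx22_eta [RHS]mx22_eta !mxE /=.
congr mx22; rewrite ?mulr1n ?mulr0n; first [by rewrite -uv; ring | ring].
Qed.

(** For [w = (u, v)] and [z = (x, y)] the product is [w z^T] times the scalar [w^T N z], which is
    the left-hand side of the hypothesis. *)
Lemma proj_excludes (N : 'M[R]_2) (u v x y : R) :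
  u * (N 0 0 * x + N 0 1 * y) + v * (N 1 0 * x + N 1 1 * y) = 0 ->
  proj u v *m map_mx (real_complex R) N *m (proj x y)^T = 0.
Proof.
move=> h; rewrite /proj map_trmx -!map_mxM -(map_mx0 (real_complex R)); congr map_mx.
rewrite tr_mx22 [N in _ *m N]mx22_eta [LHS]mx22_eta [RHS]mx22_eta !mxE !sum2 !mxE !sum2 !mxE /=.
have k (a b : R) : a * b * (u * (N 0 0 * x + N 0 1 * y) + v * (N 1 0 * x + N 1 1 * y)) = 0.
  by rewrite h mulr0.
by congr mx22; [rewrite -(k u x)|rewrite -(k u y)|rewrite -(k v x)|rewrite -(k v y)]; ring.
Qed.

(** [Q, Q'] and [T, T'] are Bob's measurements in response to Alice's outcomes [P] and [P']. *)
Lemma LOCC_two_rounds (P P' Q Q' T T' : M2 R) :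
  instrument [:: P; P'] -> instrument [:: Q; Q'] -> instrument [:: T; T'] ->
  LOCC [:: (P, Q); (P, Q'); (P', T); (P', T')].
Proof.
move=> IP IQ IT; have L0 := @LOCC_Alice R [::] 1%:M 1%:M [::] _ (LOCC_triv R) IP.
rewrite /= !mulmx1 in L0.
have L1 := @LOCC_Bob R [::] P 1%:M [:: (P', 1%:M)] _ L0 IQ.
rewrite /= !mulmx1 in L1.
have := @LOCC_Bob R [:: (P, Q); (P, Q')] P' 1%:M [::] _ L1 IT.
by rewrite /= !mulmx1.
Qed.

(* The first party measures along an isotropic direction of [N1 *m N2^T]; either
   outcome leaves the second party with two orthogonal vectors of the plane. *)
Lemma Walgate_pair (N1 N2 : 'M[R]_2) (psi1 psi2 : ket2 R) :
  amplitudes psi1 = map_mx (real_complex R) N1 ->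
  amplitudes psi2 = map_mx (real_complex R) N2 ->
  \tr (N1 *m N2^T) = 0 ->
  exists2 s, LOCC s & forall l, l \in s -> ~~ reaches l psi1 \/ ~~ reaches l psi2.
Proof.
move=> E1 E2 tr0.
set T := N1 *m N2^T in tr0.
(* The quadratic form of [T] is doubled to avoid halving its off-diagonal coefficient. *)
have [u [v [uv isot]]] := isotropic_direction (T 0 0 *+ 2) (T 0 1 + T 1 0).
pose row (N : 'M[R]_2) x y j := x * N 0 j + y * N 1 j.
have TE i j : T i j = N1 i 0 * N2 j 0 + N1 i 1 * N2 j 1.
  by rewrite mxE sum2 !mxE.
have T11 : T 1 1 = - T 0 0.
  by apply/eqP; rewrite -addr_eq0 addrC; apply/eqP; rewrite -tr0 /mxtrace sum2.
(* As [T] has trace zero, the direction orthogonal to an isotropic one is isotropic as well. *)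
have orth x y : (x = u /\ y = v) \/ (x = - v /\ y = u) ->
    row N1 x y 0 * row N2 x y 0 + row N1 x y 1 * row N2 x y 1 = 0.
  move=> xy.
  have -> : row N1 x y 0 * row N2 x y 0 + row N1 x y 1 * row N2 x y 1
     = x ^+ 2 * T 0 0 + x * y * (T 0 1 + T 1 0) + y ^+ 2 * T 1 1.
    by rewrite !TE /row; ring.
  by rewrite T11; case: xy => -[-> ->]; nra.
have split_ x y : (x = u /\ y = v) \/ (x = - v /\ y = u) ->
    exists Q Q', [/\ instrument [:: Q; Q'], ~~ reaches (proj x y, Q) psi1
                   & ~~ reaches (proj x y, Q') psi2].
  move=> /orth/separating_direction[a [b [ab h1 h2]]].
  exists (proj a b), (proj (- b) a); split; first exact: instrument_proj.
    rewrite reachesE negbK E1; apply/eqP/proj_excludes; rewrite -h1 /row /=; ring.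
  rewrite reachesE negbK E2; apply/eqP/proj_excludes; rewrite -h2 /row /=; ring.
have [|Q [Q' [IQ hQ hQ']]] := split_ u v; first by left.
have [|P [P' [IP hP hP']]] := split_ (- v) u; first by right.
exists [:: (proj u v, Q); (proj u v, Q'); (proj (- v) u, P); (proj (- v) u, P')].
  exact: LOCC_two_rounds (instrument_proj uv) IQ IP.
by move=> l; rewrite !inE => /or4P[] /eqP ->; [left|right|left|right].
Qed.

Lemma adaptive_ok_card n (st : 'I_n -> ket2 R) :
  (forall i j, i != j -> exists2 s, LOCC s &
     forall l, l \in s -> ~~ reaches l (st i) \/ ~~ reaches l (st j)) ->
  forall k (S : {set 'I_n}), (#|S| <= k.+1)%N -> adaptive_ok st k S.
Proof.
move=> pairs; elim=> [|k IH] S Sk /=; first by move/card_le1_eqP: Sk => Sk i j iS jS; apply: Sk.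
(* With at most one candidate left, the copy is spent on the trivial protocol. *)
have [S1|] := leqP #|S| 1.
  exists [:: (1%:M, 1%:M)]; split; first exact: LOCC_triv.
  move=> l _; apply: IH; apply: leq_trans (leq_trans S1 _) => //.
  by apply/subset_leq_card/fintype.subsetP => i; rewrite inE => /andP[].
move=> /card_gt1P[i [j [iS jS ij]]]; have [s Ls sP] := pairs i j ij.
exists s; split=> // l /sP ls; apply: IH; rewrite -ltnS (leq_trans _ Sk) //.
apply: proper_card; apply/fintype.properP; split.
  by apply/fintype.subsetP => x; rewrite inE => /andP[].
by case: ls => h; [exists i|exists j] => //; rewrite inE negb_and h orbT.
Qed.
End UpperBound.

Theorem theorem2 (R : realType) (al be : R) :
  0 <= al <= pi / 2 -> 0 <= be <= pi / 2 ->
  al != be -> al != pi / 2 - be ->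
  forall k : nat,
    adaptive_LOCC_distinguishable (basis_state al be) k <-> (3 <= k)%N.
Proof.
move=> ha hb ab ab' k; have G := generic_angles ha hb ab ab'.
rewrite /adaptive_LOCC_distinguishable; split=> [|k3].
  case: k => [|[|[|//]]].
  - by move/not_adaptive_ok0.
  - by move/(adaptive_ok1_card G); rewrite cardsT card_ord.
  - by move/(not_adaptive_ok2 G).
apply: adaptive_ok_card; last by rewrite cardsT card_ord.
move=> i j ij; apply: Walgate_pair (amplitudes_basis_state _ _ _) (amplitudes_basis_state _ _ _) _.
exact: family_orthogonal (generic_norm G) (generic_norm' G) ij.
Qed.
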